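(* Let $p:\mathbf{E}\to\mathbf{B}$ be a fibration, or a structure over $\mathbf{B}$. Let $B\in\mathrm{Ob}\,\mathbf{B}$, let $E\in\mathrm{Ob}\,\mathbf{E}$ with $p(E)=B$, and let $g\in\mathbf{Aut}_{\mathbf{B}}(B)$. Then $g$ can be lifted to some $g'\in\mathbf{Aut}_{\mathbf{E}}(E)$ (i.e. $p(g')=g$) if and only if there is a vertical isomorphism $\mathbf{Cart}_g(E)\cong E$.
   Context: Let $p:\mathbf{E}\to\mathbf{B}$ be a functor. A morphism $\tilde f:E'\to E$ is cartesian over $f:B'\to p(E)$ if $p(\tilde f)=f$ and for every $f':E''\to E$ and $g:p(E'')\to B'$ with $p(f')=f\circ g$ there is a unique $\tilde g:E''\to E'$ with $f'=\tilde f\circ\tilde g$ and $p(\tilde g)=g$. $p$ is a fibration if every $f:B'\to p(E)$ has a cartesian lifting with codomain $E$. $p$ is a structure over $\mathbf{B}$ if every isomorphism $f:B'\to p(E)$ of $\mathbf{B}$ can be lifted to an isomorphism $\tilde f:E'\to E$ of $\mathbf{E}$ with $p(\tilde f)=f$ (such a lift is cartesian). A morphism $v$ of $\mathbf{E}$ is vertical if $p(v)$ is an identity. $\mathbf{Cart}_g(E)$ denotes the domain of a chosen cartesian lifting $\tilde g:\mathbf{Cart}_g(E)\to E$ of $g$ with codomain $E$ (in the case of a structure: of a chosen lifting of $g$ to an isomorphism with codomain $E$); it is determined up to vertical isomorphism. *)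

(* Defs.v *)
Set Implicit Arguments.
Unset Strict Implicit.
Unset Printing Implicit Defensive.

Declare Scope cat_scope.
Delimit Scope cat_scope with cat.

Record category := Category {
  obj :> Type;
  hom : obj -> obj -> Type;
  idm : forall x, hom x x;
  comp : forall x y z, hom y z -> hom x y -> hom x z;
  comp_idl : forall x y (f : hom x y), comp (idm y) f = f;
  comp_idr : forall x y (f : hom x y), comp f (idm x) = f;
  compA : forall w x y z (h : hom y z) (g : hom x y) (f : hom w x),
    comp h (comp g f) = comp (comp h g) f
}.

Arguments idm {c} x.

Notation "x ~> y" := (hom x y) (at level 90, y at level 90) : cat_scope.
Notation "g '\oo' f" := (comp g f) (at level 50, left associativity) : cat_scope.
Open Scope cat_scope.

Record functor (C D : category) := Functor {
  fobj :> C -> D;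
  fmap : forall x y : C, (x ~> y) -> (fobj x ~> fobj y);
  fmap_id : forall x : C, fmap (idm x) = idm (fobj x);
  fmap_comp : forall (x y z : C) (g : y ~> z) (f : x ~> y),
    fmap (g \oo f) = fmap g \oo fmap f
}.

Definition is_iso (C : category) (x y : C) (f : x ~> y) : Prop :=
  exists g : y ~> x, g \oo f = idm x /\ f \oo g = idm y.

(* A morphism bundled with its domain and codomain.  Equality of arrows is
   equality of morphisms in the usual sense, which includes equality of the
   endpoints; it makes sense even when the endpoints are not definitionally
   the same. *)
Definition arrow (C : category) : Type := {x : C & {y : C & x ~> y}}.

Definition arr (C : category) (x y : C) (f : x ~> y) : arrow C :=
  existT _ x (existT _ y f).

Section OverBase.

Variables (E B : category) (p : functor E B).

(* [p(u) = f]; in particular [p x = a] and [p y = b]. *)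
Definition lies_over (x y : E) (u : x ~> y) (a b : B) (f : a ~> b) : Prop :=
  arr (fmap p u) = arr f.

Definition vertical (x y : E) (v : x ~> y) : Prop :=
  exists b : B, lies_over v (idm b).

Definition cartesian_over (e' e : E) (u : e' ~> e) (b' b : B) (f : b' ~> b) :
    Prop :=
  lies_over u f /\
  forall (e'' : E) (w : e'' ~> e) (g : p e'' ~> b'),
    lies_over w (f \oo g) ->
    exists! t : e'' ~> e', w = u \oo t /\ lies_over t g.

Definition is_fibration : Prop :=
  forall (e : E) (b' : B) (f : b' ~> p e),
    exists (e' : E) (u : e' ~> e), cartesian_over u f.

Definition is_structure : Prop :=
  forall (e : E) (b' : B) (f : b' ~> p e), is_iso f ->
    exists (e' : E) (u : e' ~> e), is_iso u /\ lies_over u f.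

(* An arbitrary choice of [Cart_g(e)] together with its lifting to [e]:
   cartesian for a fibration, an isomorphism for a structure. *)
Record chosen_lifting (b' b : B) (g : b' ~> b) (e : E) := ChosenLifting {
  Cart : E;
  Cart_mor : Cart ~> e;
  Cart_morP : (is_fibration /\ cartesian_over Cart_mor g) \/
              (is_structure /\ is_iso Cart_mor /\ lies_over Cart_mor g)
}.

End OverBase.

(* Main.v *)
(** A chosen lifting [u : Cart L ~> e] of [g] is an isomorphism even when it is
    only known to be cartesian, because [g] is one.  Composing with [u] then
    exchanges the automorphisms [g'] of [e] over [g] and the vertical
    isomorphisms [v : Cart L ~> e], via [v = g'^-1 u] and [g' = u v^-1]. *)
Require Import Defs.
From Stdlib Require Import Eqdep.

Section Arrows.

Set Implicit Arguments.
Unset Strict Implicit.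

Variable C : category.

Lemma arr_dom (x y x' y' : C) (f : x ~> y) (f' : x' ~> y') :
  arr f = arr f' -> x = x'.
Proof. exact (@f_equal _ _ (@projT1 _ _) (arr f) (arr f')). Qed.

Lemma arr_cod (x y x' y' : C) (f : x ~> y) (f' : x' ~> y') :
  arr f = arr f' -> y = y'.
Proof. exact (@f_equal _ _ (fun a => projT1 (projT2 a)) (arr f) (arr f')). Qed.

(** Each [inj_pair2] strips one endpoint; it rests on uniqueness of identity proofs, as equality of
    objects need not be decidable. *)
Lemma arr_inj (x y : C) (f f' : x ~> y) : arr f = arr f' -> f = f'.
Proof.
intros H. apply inj_pair2 in H. apply inj_pair2 in H. exact H.
Qed.

(* The two hypotheses identify [y] with [y'] by possibly different proofs, so
   uniqueness of identity proofs is genuinely used here. *)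
Lemma arr_comp (x y z x' y' z' : C) (f : x ~> y) (h : y ~> z)
    (f' : x' ~> y') (h' : y' ~> z') :
  arr f = arr f' -> arr h = arr h' -> arr (h \oo f) = arr (h' \oo f').
Proof.
intros Hf Hh.
pose proof (arr_dom Hf); pose proof (arr_cod Hf); pose proof (arr_cod Hh).
subst x' y' z'.
now rewrite (arr_inj Hf), (arr_inj Hh).
Qed.

(** A left inverse and a right inverse of the same morphism coincide. *)
Lemma arr_inverse (x y x' y' : C) (f : x ~> y) (h : y ~> x)
    (f' : x' ~> y') (h' : y' ~> x') :
  h \oo f = idm x -> f' \oo h' = idm y' -> arr f = arr f' -> arr h = arr h'.
Proof.
intros Hh Hh' Hf.
pose proof (arr_dom Hf); pose proof (arr_cod Hf); subst x' y'.
apply arr_inj in Hf; subst f'; f_equal.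
now rewrite <- (comp_idr h), <- Hh', compA, Hh, comp_idl.
Qed.

Lemma arr_idm_cast (x y : C) :
  x = y -> exists k : x ~> y, arr k = arr (idm x) /\ arr k = arr (idm y).
Proof. intros []. now exists (idm x). Qed.

Lemma is_iso_comp (x y z : C) (f : x ~> y) (h : y ~> z) :
  is_iso f -> is_iso h -> is_iso (h \oo f).
Proof.
intros [f' [f'f ff']] [h' [h'h hh']].
exists (f' \oo h'); split.
- now rewrite <- compA, (compA h'), h'h, comp_idl.
- now rewrite <- compA, (compA f), ff', comp_idl.
Qed.

Lemma is_iso_inverse (x y : C) (f : x ~> y) (h : y ~> x) :
  h \oo f = idm x -> f \oo h = idm y -> is_iso h.
Proof. intros hf fh. now exists f. Qed.

End Arrows.

Section LiesOver.

Set Implicit Arguments.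
Unset Strict Implicit.

Variables (E B : category) (p : functor E B).

Lemma lies_over_comp (x y z : E) (u : x ~> y) (w : y ~> z)
    (a b c : B) (f : a ~> b) (h : b ~> c) :
  lies_over p u f -> lies_over p w h -> lies_over p (w \oo u) (h \oo f).
Proof.
unfold lies_over; intros Hu Hw; rewrite fmap_comp; now apply arr_comp.
Qed.

Lemma lies_over_inverse (x y : E) (u : x ~> y) (u' : y ~> x)
    (a b : B) (f : a ~> b) (f' : b ~> a) :
  u' \oo u = idm x -> f \oo f' = idm b ->
  lies_over p u f -> lies_over p u' f'.
Proof.
intros u'u ff'; apply arr_inverse; [|exact ff'].
now rewrite <- fmap_comp, u'u, fmap_id.
Qed.

(** Factoring [idm e] through [u] over the inverse of [g] gives a right inverse [t]. It is also a
    left inverse, since [t \oo u] and [idm x] both factor [u] through itself over an identity. *)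
Lemma cartesian_over_is_iso (x e : E) (u : x ~> e) (b' : B) (g : b' ~> p e) :
  cartesian_over p u g -> is_iso g -> is_iso u.
Proof.
intros [Hu univ] [h [hg gh]].
destruct (univ e (idm e) h) as [t [[ut tP] _]].
{ unfold lies_over; now rewrite gh, fmap_id. }
(* [k] is the identity of [p x = b'], typed so that both [idm x] and [t \oo u]
   are factorizations of [u] through itself over [k]. *)
destruct (arr_idm_cast (arr_dom Hu)) as [k [kl kr]].
assert (gk : arr (g \oo k) = arr g).
{ rewrite (arr_comp kr (eq_refl (arr g))); now rewrite comp_idr. }
destruct (univ x u k) as [s [_ uniq]].
{ exact (eq_trans Hu (eq_sym gk)). }
exists t; split; [|now symmetry].
transitivity s; [symmetry|]; apply uniq; split.
- now rewrite compA, <- ut, comp_idl.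
- pose proof (lies_over_comp Hu tP) as H; rewrite hg in H.
  exact (eq_trans H (eq_sym kr)).
- now rewrite comp_idr.
- unfold lies_over; now rewrite fmap_id.
Qed.

Lemma Cart_mor_iso_over (b' : B) (e : E) (g : b' ~> p e)
    (L : chosen_lifting p g e) :
  is_iso g -> is_iso (Cart_mor L) /\ lies_over p (Cart_mor L) g.
Proof.
intros hg; destruct (Cart_morP L) as [[_ cart]|[_ H]]; [|exact H].
split; [exact (cartesian_over_is_iso cart hg) | exact (proj1 cart)].
Qed.

End LiesOver.

Theorem proposition7p2 (E B : category) (p : functor E B)
    (hp : is_fibration p \/ is_structure p)
    (b : B) (e : E) (he : p e = b) (g : hom b b) (hg : is_iso g)
    (L : chosen_lifting p g e) :
  (exists g' : hom e e, is_iso g' /\ lies_over p g' g) <->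
  (exists v : hom (Cart L) e, is_iso v /\ vertical p v).
Proof.
subst b.
destruct (Cart_mor_iso_over L hg) as [uiso uP].
split.
- intros [g' [[w [wg' g'w]] g'P]].
  destruct hg as [h [hg gh]].
  exists (w \oo Cart_mor L); split.
  + exact (is_iso_comp uiso (is_iso_inverse wg' g'w)).
  (* The identity of [p e] is written as [h \oo g], with [w] over [h] and the lifting over [g]. *)
  + exists (p e); rewrite <- hg.
    exact (lies_over_comp uP (lies_over_inverse wg' gh g'P)).
- intros [v [[w [wv vw]] [b vP]]].
  (* The codomain of [v] is [e], so the identity below [v] is that of [p e]. *)
  pose proof (arr_cod vP); subst b.
  exists (Cart_mor L \oo w); split.
  + exact (is_iso_comp (is_iso_inverse wv vw) uiso).
  (* The inverse [w] of a vertical morphism lies over an identity, so [g] is split as [g] after that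
     identity. *)
  + rewrite <- (comp_idr g).
    exact (lies_over_comp (lies_over_inverse wv (comp_idl _) vP) uP).
Qed.
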